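(* Let $X\subseteq E$ be nonempty, convex and compact. Let $F:X\to E^*$ be monotone on $X$, i.e. $\langle F(x)-F(y),x-y\rangle\ge 0$ for all $x,y\in X$, and Lipschitz continuous with constant $L>0$, i.e. $\|F(x)-F(y)\|_*\le L\|x-y\|$ for all $x,y\in X$. Let $\psi:X\to\mathbb{R}$ be continuously differentiable and strongly convex with constant $\alpha>0$, i.e. $\psi(y)\ge\psi(x)+\langle\nabla\psi(x),y-x\rangle+\frac{\alpha}{2}\|y-x\|^2$ for all $x,y\in X$. Let $\gamma=\frac{\alpha}{2L}$, let $x_0,y_0\in X$, and let the sequences $\{x_t\}_{t\ge0},\{y_t\}_{t\ge0}\subseteq X$ be generated by the Popov mirror-prox updates, for $t=0,1,2,\dots$, $$y_{t+1}=\operatorname*{argmin}_{z\in X}\big[\langle\gamma F(y_t)-\nabla\psi(x_t),z\rangle+\psi(z)\big],$$ $$x_{t+1}=\operatorname*{argmin}_{z\in X}\big[\langle\gamma F(y_{t+1})-\nabla\psi(x_t),z\rangle+\psi(z)\big].$$ Then for all $T\ge1$, $$G(y^{(T+1)})\le\frac{2L}{(T+1)\alpha}\max_{u\in X}B_\psi(u,x_0)+\frac{L}{T+1}\|y_0-x_0\|^2,$$ where $y^{(T+1)}=\frac{1}{T+1}\sum_{t=0}^{T}y_{t+1}$, $G(x)=\max_{u\in X}\langle F(u),x-u\rangle$ for $x\in X$ is the dual gap function, and $B_\psi(u,x)=\psi(u)-\psi(x)-\langle\nabla\psi(x),u-x\rangle$ for $u,x\in X$ is the Bregman divergence induced by 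$\psi$.
   Context: $E$ is a real Euclidean (inner product) space, not necessarily finite dimensional, equipped with a norm $\|\cdot\|$ that need not be the one induced by the inner product. $E^*$ is the dual space of $E$ (with respect to $\|\cdot\|$), $\langle\cdot,\cdot\rangle$ denotes the pairing between $E^*$ and $E$ (written in either order), and $E^*$ carries the dual norm $\|y\|_*=\max_{\|x\|\le1}\langle y,x\rangle$ (read as a supremum if not attained). Compactness and continuity are with respect to $\|\cdot\|$ on $E$ and $\|\cdot\|_*$ on $E^*$. Convention: $\psi:X\to\mathbb{R}$ continuously differentiable means that there is a continuous gradient map $\nabla\psi:X\to E^*$ (fixed throughout) with $\psi(y)=\psi(x)+\langle\nabla\psi(x),y-x\rangle+o(\|y-x\|)$ as $y\to x$ in $X$, for every $x\in X$. Each argmin in the updates is the unique minimizer, since it is the minimization of a continuous strongly convex function over a nonempty convex compact set. *)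

(* Defs.v *)
From HB Require Import structures.
From mathcomp Require Import all_boot all_order all_algebra.
From mathcomp Require Import all_classical all_reals all_analysis.

Set Implicit Arguments.
Unset Strict Implicit.
Unset Printing Implicit Defensive.

Import Order.TTheory GRing.Theory Num.Theory.
Import numFieldNormedType.Exports.

Local Open Scope classical_set_scope.
Local Open Scope ring_scope.

(* Functions on a subset X of E are represented by total functions on E whose
   values outside X are never used. *)

(* The topological dual; the pairing <f, x> is the application [f x]. *)
Record dual (R : realType) (E : normedModType R) := Dual {
  dual_fun :> {linear E -> R^o} ;
  dual_continuous : continuous dual_fun }.

(* For continuous linear f the supremum is over a nonempty bounded set.  The
   argument is a bare function so that it applies to differences [f \- g]. *)
Definition dual_norm (R : realType) (E : normedModType R) (f : E -> R) : R :=
  sup [set f x | x in [set x : E | `|x| <= 1]].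

Definition monotone_on (R : realType) (E : normedModType R) (X : set E)
    (F : E -> dual E) : Prop :=
  forall x y, X x -> X y -> 0 <= (F x \- F y) (x - y).

Definition lipschitz_dual_on (R : realType) (E : normedModType R) (X : set E)
    (L : R) (F : E -> dual E) : Prop :=
  forall x y, X x -> X y -> dual_norm (F x \- F y) <= L * `|x - y|.

Definition continuously_differentiable_on (R : realType) (E : normedModType R)
    (X : set E) (psi : E -> R) (dpsi : E -> dual E) : Prop :=
  (forall x, X x ->
     dual_norm (dpsi y \- dpsi x) @[y --> within X (nbhs x)] --> (0 : R)) /\
  (forall x, X x -> forall y,
     (psi y : R^o) = psi x + dpsi x (y - x)
       +o_(y \near within X (nbhs x)) (y - x)).

Definition strongly_convex_on (R : realType) (E : normedModType R) (X : set E)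
    (alpha : R) (psi : E -> R) (dpsi : E -> dual E) : Prop :=
  forall x y, X x -> X y ->
    psi x + dpsi x (y - x) + alpha / 2 * `|y - x| ^+ 2 <= psi y.

Definition argmin (R : realType) (E : Type) (X : set E) (f : E -> R) : set E :=
  [set z | X z /\ forall w, X w -> f z <= f w].

Definition bregman (R : realType) (E : normedModType R) (psi : E -> R)
    (dpsi : E -> dual E) (u x : E) : R :=
  psi u - psi x - dpsi x (u - x).

(* The maximum of f over X.  As a real supremum it is the maximum whenever that
   is attained, in particular for f continuous on a nonempty compact X. *)
Definition max_on (R : realType) (E : Type) (X : set E) (f : E -> R) : R :=
  sup [set f u | u in X].

Definition dual_gap (R : realType) (E : normedModType R) (X : set E)
    (F : E -> dual E) (x : E) : R :=
  max_on X (fun u => F u (x - u)).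

Definition popov_mirror_prox (R : realType) (E : normedModType R) (X : set E)
    (F : E -> dual E) (psi : E -> R) (dpsi : E -> dual E) (gamma : R)
    (x y : nat -> E) : Prop :=
  forall t,
    argmin X (fun z => (gamma * F (y t) z - dpsi (x t) z) + psi z) (y t.+1) /\
    argmin X (fun z => (gamma * F (y t.+1) z - dpsi (x t) z) + psi z) (x t.+1).

(* Main.v *)
(* Write x, y, x', y' for x_t, y_t, x_{t+1}, y_{t+1}.  The optimality conditions
   of the two prox steps (tested at x' and at u) give, by the three-point
   identity for the Bregman divergence B,
     gamma <F y', y' - u> <= B(u, x) - B(u, x') - B(x', y') - B(y', x)
                              + gamma <F y' - F y, y' - x'>.
   With a = |y' - y|, b = |y' - x'|, c = |y' - x|, d = |y - x|, the last term is
   at most (alpha / 2) a b, and the divergences at least (alpha / 2) b^2 and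
   (alpha / 2) c^2.  The prox map being nonexpansive, b <= a / 2, hence
   a b <= a^2 / 2 <= (c + d)^2 / 2 <= c^2 + d^2, so that the error is at most
   (alpha / 2) (d^2 - b^2), which telescopes because b is the next d. *)
Require Import Defs.
From HB Require Import structures.
From mathcomp Require Import all_boot all_order all_algebra.
From mathcomp Require Import all_classical all_reals all_analysis.
From mathcomp Require Import ring lra.

Set Implicit Arguments.
Unset Strict Implicit.
Unset Printing Implicit Defensive.

Import Order.TTheory GRing.Theory Num.Theory.
Import numFieldNormedType.Exports.

Local Open Scope classical_set_scope.
Local Open Scope ring_scope.

(** Continuity bounds [f] on the unit ball, so the [sup] in [dual_norm] is a genuine upper bound; it
    is tested at [x] divided by its norm. *)
Lemma ler_dual_norm (R : realType) (E : normedModType R) (f : {linear E -> R^o})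
    (x : E) :
  continuous f -> f x <= dual_norm f * `|x|.
Proof.
move=> /linear_bounded_continuous/linear_boundedP/pinfty_ex_gt0[r r_gt0 f_le].
have [->|x_neq0] := eqVneq x 0; first by rewrite linear0 normr0 mulr0.
have nx_gt0 : 0 < `|x| by rewrite normr_gt0.
rewrite -ler_pdivrMr// mulrC -[_ * f x]/(`|x|^-1 *: (f x : R^o)) -linearZ.
apply: ub_le_sup.
  exists r => _ [z /= z_le1 <-]; apply: le_trans (ler_norm _) _.
  by apply: le_trans (f_le z) _; rewrite ler_piMr// ltW.
by exists (`|x|^-1 *: x) => //=; rewrite normrZ normfV normr_id mulVf ?gt_eqF.
Qed.

Lemma ler_dualB_norm (R : realType) (E : normedModType R) (f g : dual E)
    (x : E) :
  f x - g x <= dual_norm (f \- g) * `|x|.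
Proof.
apply: (@ler_dual_norm _ _ (f \- g)) => z.
by apply: continuousB; exact: dual_continuous.
Qed.

Lemma convex_set_segment (R : realType) (E : normedModType R) (X : set E)
    (z u : E) (s : R) :
  convex_set X -> X z -> X u -> 0 <= s -> s <= 1 -> X (z + s *: (u - z)).
Proof.
move=> cX Xz Xu s0 s1.
have -> : z + s *: (u - z) = s *: u + (1 - s) *: z.
  by rewrite scalerBl scale1r scalerBr addrCA.
exact: set_mem (cX u z (Itv01 s0 s1) (mem_set Xu) (mem_set Xz)).
Qed.

Lemma continuously_differentiable_onP (R : realType) (E : normedModType R)
    (X : set E) (psi : E -> R) (dpsi : E -> dual E) (x : E) (e : R) :
  continuously_differentiable_on X psi dpsi -> X x -> 0 < e ->
  \forall y \near within X (nbhs x),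
    `|psi y - psi x - dpsi x (y - x)| <= e * `|y - x|.
Proof.
move=> [_ /(_ x)] H Xx e_gt0.
have {}H := H Xx.
move/funext/eqaddoP: H => /(_ _ e_gt0).
by apply: filterS => y /=; rewrite !fctE opprD addrA.
Qed.

Lemma dual_subr_continuous (R : realType) (E : normedModType R) (f : dual E)
    (x : E) :
  continuous (fun y => f (y - x) : R^o).
Proof.
move=> y; under eq_fun do rewrite linearB.
by apply: cvgB; [exact: dual_continuous|exact: cvg_cst].
Qed.

(** Near [x] the first-order remainder is at most [|y - x|], so it tends to 0, and the affine part
    is continuous. *)
Lemma continuously_differentiable_on_continuous (R : realType)
    (E : normedModType R) (X : set E) (psi : E -> R) (dpsi : E -> dual E) :
  continuously_differentiable_on X psi dpsi ->
  {within X, continuous (psi : E -> R^o)}.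
Proof.
move=> C1; apply/subspace_continuousP => x Xx.
have cl : (psi y - psi x - dpsi x (y - x))
    @[y --> within X (nbhs x)] --> (0 : R^o).
  apply/cvgr0Pnorm_le => e e_gt0.
  have := continuously_differentiable_onP C1 Xx ltr01.
  have : \forall y \near within X (nbhs x), `|y - x| <= e.
    rewrite near_withinE; apply/nbhs_normP; exists e => //= y /=.
    by rewrite distrC => /ltW.
  apply: filterS2 => y yx_le; rewrite mul1r => /le_trans; exact.
have cd : continuous (fun y : E => psi x + dpsi x (y - x) : R^o).
  move=> y; apply: (@cvgD _ R^o); first exact: cvg_cst.
  exact: dual_subr_continuous.
have := cvgD cl (cvg_within_filter X (cd x)).
rewrite subrr linear0 addr0 add0r.
rewrite (_ : (_ + _)%R = psi); last by apply/funext => y; rewrite !fctE; lra.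
exact.
Qed.

(** Without this bound the [sup] in [max_on] could be a default value and would not dominate the
    divergence at each [u]. *)
Lemma bregman_has_ubound (R : realType) (E : normedModType R) (X : set E)
    (psi : E -> R) (dpsi : E -> dual E) (x : E) :
  compact X -> continuously_differentiable_on X psi dpsi ->
  has_ubound [set bregman psi dpsi u x | u in X].
Proof.
move=> cX C1.
have cB : {within X, continuous (fun u => bregman psi dpsi u x : R^o)}.
  apply/subspace_continuousP => u Xu; rewrite /from_subspace /bregman.
  apply: (@cvgB _ R^o).
    apply: (@cvgB _ R^o); last exact: cvg_cst.
    have /subspace_continuousP := continuously_differentiable_on_continuous C1.
    exact.
  by apply: cvg_within_filter; exact: dual_subr_continuous.
have /compact_bounded/pinfty_ex_gt0[M _ HM] := continuous_compact cB cX.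
exists M => r /HM /=; exact/le_trans/ler_norm.
Qed.

(* Compare z with z + s (u - z) and let s -> 0. *)
Lemma argmin_optimality (R : realType) (E : normedModType R) (X : set E)
    (h : {linear E -> R^o}) (psi : E -> R) (dpsi : E -> dual E) (z u : E) :
  convex_set X -> continuously_differentiable_on X psi dpsi ->
  argmin X (fun w => h w + psi w) z -> X u ->
  0 <= h (u - z) + dpsi z (u - z).
Proof.
move=> cX C1 [Xz z_min] Xu; set d := u - z.
apply/ler_addgt0Pr => e e_gt0.
have d1 : 0 < `|d| + 1 by rewrite ltr_wpDl.
have := continuously_differentiable_onP C1 Xz (divr_gt0 e_gt0 d1).
rewrite near_withinE => /nbhs_normP[r /= r_gt0 Hr].
(* Small enough that the point stays both on the segment and in the ball of radius [r]; the [+ 1]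
   covers [d = 0]. *)
pose s := Num.min 1 (r / 2 / (`|d| + 1)).
have s_gt0 : 0 < s by rewrite lt_min ltr01 !divr_gt0.
have s_le1 : s <= 1 by rewrite ge_min lexx.
have Xs : X (z + s *: d) by apply: convex_set_segment => //; exact: ltW.
have sd : s * (`|d| + 1) <= r / 2 by rewrite -ler_pdivlMr// ge_min lexx orbT.
have /= := Hr (z + s *: d).
rewrite opprD addNKr normrN normrZ gtr0_norm// => /(_ _ Xs).
rewrite [z + _ - z]addrAC subrr add0r normrZ gtr0_norm// => {}Hr.
have {}Hr : psi (z + s *: d) - psi z - dpsi z (s *: d)
    <= e / (`|d| + 1) * (s * `|d|).
  by apply: le_trans (ler_norm _) (Hr _); nra.
have hm := z_min _ Xs.
have dZ : dpsi z (s *: d) = s * dpsi z d by exact: linearZ.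
have hD : h (z + s *: d) = h z + s * h d.
  by rewrite linearD; congr +%R; exact: linearZ.
rewrite dZ in Hr; rewrite hD in hm.
have eb : e / (`|d| + 1) * `|d| <= e.
  by rewrite mulrAC ler_pdivrMr// ler_pM2l// lerDl.
(* Minimality and the remainder bound give [0 <= s * (h d + dpsi z d + e)]. *)
by rewrite -(pmulr_rge0 _ s_gt0); nra.
Qed.

Lemma prox_optimality (R : realType) (E : normedModType R) (X : set E)
    (gamma : R) (g p : dual E) (psi : E -> R) (dpsi : E -> dual E) (z u : E) :
  convex_set X -> continuously_differentiable_on X psi dpsi ->
  argmin X (fun w => (gamma * g w - p w) + psi w) z -> X u ->
  0 <= gamma * g (u - z) - p (u - z) + dpsi z (u - z).
Proof.
exact: (argmin_optimality (h := (gamma \*: (g : E -> R^o)) \- p)).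
Qed.

Lemma dualB (R : realType) (E : normedModType R) (f : dual E) (a b : E) :
  f (a - b) = f a - f b :> R.
Proof. exact: linearB. Qed.

Lemma popov_step (R : realType) (E : normedModType R) (X : set E)
    (F : E -> dual E) (psi : E -> R) (dpsi : E -> dual E)
    (L alpha gamma : R) (x y x' y' u : E) :
  convex_set X -> 0 < L -> lipschitz_dual_on X L F ->
  continuously_differentiable_on X psi dpsi ->
  0 < alpha -> strongly_convex_on X alpha psi dpsi ->
  gamma = alpha / (2 * L) -> X x -> X y -> X u ->
  argmin X (fun z => (gamma * F y z - dpsi x z) + psi z) y' ->
  argmin X (fun z => (gamma * F y' z - dpsi x z) + psi z) x' ->
  gamma * F y' (y' - u) + alpha / 2 * `|y' - x'| ^+ 2 + bregman psi dpsi u x'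
    <= bregman psi dpsi u x + alpha / 2 * `|y - x| ^+ 2.
Proof.
move=> cX L0 lipF C1 a0 sc gammaE Xx Xy Xu my mx.
have [Xy' _] := my; have [Xx' _] := mx.
have oy := prox_optimality cX C1 my Xx'.
have ox := prox_optimality cX C1 mx Xu.
have ox' := prox_optimality cX C1 mx Xy'.
have sxy := sc _ _ Xx' Xy'.
have syx := sc _ _ Xy' Xx'.
have sy := sc _ _ Xx Xy'.
have g0 : 0 <= gamma by rewrite gammaE divr_ge0 ?mulr_ge0 ?ltW.
have dF := ler_dualB_norm (F y') (F y) (y' - x').
have {}dF : gamma * (F y' (y' - x') - F y (y' - x'))
    <= alpha / 2 * (`|y' - y| * `|y' - x'|).
  (* The step size is chosen for exactly this identity. *)
  have -> : alpha / 2 = gamma * L by rewrite gammaE; field; rewrite gt_eqF.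
  rewrite -mulrA ler_wpM2l// mulrA.
  by apply: le_trans dF _; rewrite ler_wpM2r// lipF.
have tri : `|y' - y| <= `|y' - x| + `|y - x|.
  by rewrite (distrC y x); exact: ler_distD.
rewrite [`|x' - y'|]distrC in syx.
move: (normr_ge0 (y' - x')) (normr_ge0 (y' - x)) (normr_ge0 (y - x))
  (normr_ge0 (y' - y)) tri.
(* With each functional split over differences, its values at points become atoms and what remains
   is real arithmetic. *)
rewrite /bregman !dualB in oy ox ox' sxy syx sy dF *.
move: oy ox ox' sxy syx sy dF.
move: `|y' - x'| `|y' - x| `|y - x| `|y' - y| => b c d a.
move=> oy ox ox' sxy syx sy dF b0 c0 d0 aa0 tri.
(* Adding [oy] and [ox'] cancels [dpsi x]; [sxy] and [syx] make the gradient difference at least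
   [alpha * b ^+ 2], while [dF] bounds the other side by [alpha / 2 * (a * b)]. *)
have b_le : b <= a / 2.
  have : alpha * (b * b) <= alpha * (b * (a / 2)) by lra.
  rewrite ler_pM2l//; have [->|b_neq0] := eqVneq b 0; first by move=> _; lra.
  by rewrite ler_pM2l// lt_def b_neq0.
have key : alpha / 2 * (a * b) <= alpha / 2 * (c ^+ 2 + d ^+ 2).
  rewrite ler_pM2l ?divr_gt0//.
  have : 0 <= (c - d) ^+ 2 by exact: sqr_ge0.
  have : a * b <= a * (a / 2) by rewrite ler_wpM2l.
  have : a ^+ 2 <= (c + d) ^+ 2 by rewrite lerXn2r// nnegrE addr_ge0.
  lra.
lra.
Qed.

Theorem theorem1 (R : realType) (E : normedModType R)
    (ip : {dot E for (idfun : R -> R)})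
    (X : set E) (F : E -> dual E) (psi : E -> R) (dpsi : E -> dual E)
    (L alpha gamma : R) (x y : nat -> E)
    (X_nonempty : X !=set0) (X_convex : convex_set X) (X_compact : compact X)
    (F_monotone : monotone_on X F)
    (L_gt0 : 0 < L) (F_lipschitz : lipschitz_dual_on X L F)
    (psi_C1 : continuously_differentiable_on X psi dpsi)
    (alpha_gt0 : 0 < alpha)
    (psi_strongly_convex : strongly_convex_on X alpha psi dpsi)
    (gamma_def : gamma = alpha / (2 * L))
    (x0_in : X (x 0%N)) (y0_in : X (y 0%N))
    (updates : popov_mirror_prox X F psi dpsi gamma x y)
    (T : nat) (T_ge1 : (1 <= T)%N) :
  dual_gap X F ((T.+1%:R : R)^-1 *: \sum_(0 <= t < T.+1) y t.+1)
    <= 2 * L / (T.+1%:R * alpha) * max_on X (fun u => bregman psi dpsi u (x 0%N))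
       + L / T.+1%:R * `|y 0%N - x 0%N| ^+ 2.
Proof.
have Xx t : X (x t) by case: t => // t; have [_ []] := updates t.
have Xy t : X (y t) by case: t => // t; have [[]] := updates t.
have gamma_gt0 : 0 < gamma by rewrite gamma_def divr_gt0 ?mulr_gt0.
(* It suffices to bound the pairing for each fixed [u], the set under the [sup] being nonempty. *)
apply: ge_sup.
  by have [u Xu] := X_nonempty; eexists; exists u.
move=> _ [u Xu <-].
(* Monotonicity trades [F (y t.+1)] for the fixed functional [F u], so that the sum over [t] can
   later pass to the average by linearity. *)
have step t : gamma * F u (y t.+1 - u) + alpha / 2 * `|y t.+1 - x t.+1| ^+ 2
      + bregman psi dpsi u (x t.+1)
    <= bregman psi dpsi u (x t) + alpha / 2 * `|y t - x t| ^+ 2.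
  have [my mx] := updates t.
  apply: le_trans (popov_step X_convex L_gt0 F_lipschitz psi_C1 alpha_gt0
    psi_strongly_convex gamma_def (Xx t) (Xy t) Xu my mx).
  by rewrite -!addrA lerD2r ler_pM2l// -subr_ge0; exact: F_monotone.
(* The nonnegative terms at [n] are kept to make the induction close, and dropped only at [T.+1]. *)
have sum_le n : gamma * (\sum_(0 <= t < n) F u (y t.+1 - u))
      + alpha / 2 * `|y n - x n| ^+ 2 + bregman psi dpsi u (x n)
    <= bregman psi dpsi u (x 0%N) + alpha / 2 * `|y 0%N - x 0%N| ^+ 2.
  elim: n => [|n IHn]; first by rewrite big_nil mulr0 add0r addrC.
  by rewrite big_nat_recr//= mulrDr; have := step n; lra.
have breg_ge0 : 0 <= bregman psi dpsi u (x T.+1).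
  have := psi_strongly_convex _ _ (Xx T.+1) Xu.
  have : 0 <= alpha / 2 * `|u - x T.+1| ^+ 2.
    by rewrite mulr_ge0 ?sqr_ge0 ?divr_ge0 ?ltW.
  by rewrite /bregman; lra.
have breg_le : bregman psi dpsi u (x 0%N)
    <= max_on X (fun u => bregman psi dpsi u (x 0%N)).
  by apply: ub_le_sup; [exact: bregman_has_ubound|exists u].
set S := \sum_(0 <= t < T.+1) F u (y t.+1 - u).
have -> : F u (T.+1%:R^-1 *: \sum_(0 <= t < T.+1) y t.+1 - u) = T.+1%:R^-1 * S.
  have -> : T.+1%:R^-1 *: (\sum_(0 <= t < T.+1) y t.+1) - u
      = T.+1%:R^-1 *: \sum_(0 <= t < T.+1) (y t.+1 - u).
    by rewrite sumrB sumr_const_nat subn0 scalerBr -[u *+ _]scaler_nat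
      scalerA mulVf ?scale1r.
  have -> a v : F u (a *: v) = a * F u v by exact: linearZ.
  by rewrite linear_sum.
set M := max_on _ _ in breg_le *; set d := `|y 0%N - x 0%N|.
have SM : gamma * S <= M + alpha / 2 * d ^+ 2.
  have := sum_le T.+1.
  have : 0 <= alpha / 2 * `|y T.+1 - x T.+1| ^+ 2.
    by rewrite mulr_ge0 ?sqr_ge0 ?divr_ge0 ?ltW.
  by rewrite -/S -/d; lra.
(* Dividing by [gamma] turns the coefficient of [M] into [2 * L / alpha], and [alpha / 2] into
   [L]. *)
have -> : 2 * L / (T.+1%:R * alpha) * M + L / T.+1%:R * d ^+ 2
    = T.+1%:R^-1 * (gamma^-1 * (M + alpha / 2 * d ^+ 2)).
  by rewrite gamma_def; field; rewrite !gt_eqF.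
by rewrite ler_pM2l ?invr_gt0// mulrC ler_pdivlMr// mulrC.
Qed.
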